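(* Let $s\in(0,1)$, $p\in\{1,2\}$ with $p$ admissible, and $\tau\in(0,1)$. Let $B_1(0)\subset\mathbb{R}^N$ be the unit ball centered at the origin, and set $\mathcal A:=\{a\in B_1(0): B_\tau(a)\subset B_1(0)\}$. Then the map $\mathcal A\to\mathbb{R}$, $a\mapsto\lambda_{s,p}\big(B_1(0)\setminus\overline{B_\tau(a)}\big)$, attains its maximum at $a=0$.
   Context: Let $N\ge 1$ and $s\in(0,1)$. For $u\in H^s(\mathbb{R}^N)$ set $[u]_{H^s(\mathbb{R}^N)}^2=\frac{b_{N,s}}{2}\int_{\mathbb{R}^N}\int_{\mathbb{R}^N}\frac{(u(x)-u(y))^2}{|x-y|^{N+2s}}\,dx\,dy$ with $b_{N,s}=s(1-s)\pi^{-N/2}4^s\frac{\Gamma(\frac N2+s)}{\Gamma(2-s)}$. For an open set $O\subset\mathbb{R}^N$ let $\mathcal H^s_0(O)=\{w\in H^s(\mathbb{R}^N): w=0 \text{ a.e. on } \mathbb{R}^N\setminus O\}$. An exponent $p$ is admissible if $p\in[1,\frac{2N}{N-2s})$ when $2s<N$, and $p\in[1,\infty)$ when $2s\ge N$ (which forces $N=1$). For a bounded open set $O$, $\lambda_{s,p}(O):=\inf\{[u]_{H^s(\mathbb{R}^N)}^2: u\in\mathcal H^s_0(O),\ \|u\|_{L^p(O)}=1\}$. $B_r(a)$ denotes the open ball of radius $r$ centered at $a$. *)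

(* Defs.v *)
From HB Require Import structures.
From mathcomp Require Import all_boot all_order all_algebra.
From mathcomp Require Import all_classical all_reals all_analysis.
Import Order.TTheory GRing.Theory Num.Theory.
Import numFieldNormedType.Exports.
Local Open Scope classical_set_scope.
Local Open Scope ring_scope.


Section Euclid.
Variable R : realType.

(* The Euclidean space R^(n+1), realised as nested pairs
   (((x_1, x_2), x_3), ..., x_(n+1)), with its Borel product sigma-algebra. *)
Fixpoint Esig (n : nat) : {d : measure_display & measurableType d} :=
  match n with
  | 0 => existT (fun d => measurableType d) _ (measurableTypeR R : measurableType _)
  | n'.+1 => existT (fun d => measurableType d) _
      ((projT2 (Esig n') * measurableTypeR R)%type : measurableType _)
  end.

Definition E (n : nat) : measurableType (projT1 (Esig n)) := projT2 (Esig n).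

Fixpoint leb (n : nat) : {measure set (E n) -> \bar R} :=
  match n return {measure set (E n) -> \bar R} with
  | 0 => @lebesgue_measure R
  | n'.+1 => ((leb n') \x (@lebesgue_measure R))%E
  end.

Fixpoint esub (n : nat) : E n -> E n -> E n :=
  match n return E n -> E n -> E n with
  | 0 => fun x y : R => x - y
  | n'.+1 => fun x y => (esub n' x.1 y.1, x.2 - y.2)
  end.

Fixpoint ezero (n : nat) : E n :=
  match n return E n with
  | 0 => (0 : R)
  | n'.+1 => (ezero n', 0 : R)
  end.

Fixpoint esqnorm (n : nat) : E n -> R :=
  match n return E n -> R with
  | 0 => fun x : R => x ^+ 2
  | n'.+1 => fun x => esqnorm n' x.1 + x.2 ^+ 2
  end.

Definition edist (n : nat) (x y : E n) : R := Num.sqrt (esqnorm n (esub n x y)).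

End Euclid.

Section Fractional.
Variable R : realType.
Local Open Scope ereal_scope.

Definition Gamma (z : R) : R :=
  fine (\int[@lebesgue_measure R]_(t in [set t : R | (0 < t)%R])
          ((t `^ (z - 1)) * expR (- t))%:E).

Definition RN (N : nat) := E R N.-1.
Definition lebN (N : nat) : {measure set (RN N) -> \bar R} := leb R N.-1.
Definition distN (N : nat) (x y : RN N) : R := edist R N.-1 x y.
Definition originN (N : nat) : RN N := ezero R N.-1.
Definition ballN (N : nat) (a : RN N) (r : R) : set (RN N) :=
  [set x | (distN N x a < r)%R].
(* closure of B_r(a) (r > 0): the closed ball *)
Definition cballN (N : nat) (a : RN N) (r : R) : set (RN N) :=
  [set x | (distN N x a <= r)%R].

Definition bNs (N : nat) (s : R) : R :=
  (s * (1 - s) * (pi `^ (- (N%:R / 2))) * (4 `^ s)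
    * Gamma (N%:R / 2 + s) / Gamma (2 - s))%R.

Definition gagliardo (N : nat) (s : R) (u : RN N -> R) : \bar R :=
  ((bNs N s / 2)%:E) *
  \int[lebN N]_x \int[lebN N]_y
     (((u x - u y) ^+ 2 / (distN N x y `^ (N%:R + 2 * s)))%R)%:E.

Definition Hs (N : nat) (s : R) : set (RN N -> R) :=
  [set u : RN N -> R | measurable_fun setT u /\
           \int[lebN N]_x (((u x) ^+ 2)%R)%:E < +oo /\
           gagliardo N s u < +oo].

Definition Hs0 (N : nat) (s : R) (O : set (RN N)) : set (RN N -> R) :=
  [set u : RN N -> R | Hs N s u /\ {ae lebN N, forall x, ~ O x -> u x = 0%R}].

Definition LpnormOn (N : nat) (p : R) (O : set (RN N)) (u : RN N -> R)
  : \bar R :=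
  (\int[lebN N]_(x in O) ((`|u x| `^ p)%R)%:E) `^ (p^-1).

Definition lambda_sp (N : nat) (s p : R) (O : set (RN N)) : \bar R :=
  ereal_inf [set gagliardo N s u | u in
               [set u : RN N -> R | Hs0 N s O u /\ LpnormOn N p O u = 1]].

Definition admissible (N : nat) (s p : R) : Prop :=
  if (2 * s < N%:R)%R then (1 <= p /\ p < 2 * N%:R / (N%:R - 2 * s))%R
  else (1 <= p)%R.

End Fractional.

(* Main.v *)
(* Polarization. For a <> 0 let sigma be the reflection exchanging 0 and a, and
   let H be the closed half-space of the points at least as close to 0 as to a.
   For u vanishing outside B_1(0) minus the closed ball of radius tau at 0,
   replace |u| by the function v equal to max(|u|, |u| o sigma) on H and to
   min(|u|, |u| o sigma) off H. On each pair {x, sigma x} the values of v are those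
   of |u| rearranged, so all L^p norms are kept, and v vanishes outside B_1(0)
   minus the closed ball at a. The four-point sum of the Gagliardo integrand over
   {x, sigma x} x {y, sigma y} decreases pointwise, because the kernel is larger
   between points on the same side of the mirror; hence the seminorm decreases.
   The invariance of Lebesgue measure under sigma comes from writing sigma as a
   composition of shears and of a reflection in one coordinate. *)
Require Import Defs.
From HB Require Import structures.
From mathcomp Require Import all_boot all_order all_algebra.
From mathcomp Require Import all_classical all_reals all_analysis.
From mathcomp Require Import measurable_realfun ring.
Import Order.TTheory GRing.Theory Num.Theory.
Local Open Scope classical_set_scope.
Local Open Scope ring_scope.

(** * Measure-preserving maps *)

Section MeasurePreserving.
Context {R : realType}.

Definition measure_preserving d (T : measurableType d) (mu : set T -> \bar R)
    (f : T -> T) : Prop :=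
  measurable_fun setT f /\ forall A, measurable A -> mu (f @^-1` A) = mu A.
Arguments measure_preserving {d T}.

Lemma measure_preserving_comp d (T : measurableType d) (mu : set T -> \bar R)
    (f g : T -> T) :
  measure_preserving mu f -> measure_preserving mu g ->
  measure_preserving mu (f \o g).
Proof.
move=> [mf pf] [mg pg]; split; first exact: measurableT_comp.
move=> A mA; rewrite comp_preimage pg ?pf//.
by rewrite -[_ @^-1` _]setTI; exact: mf.
Qed.

Lemma measure_preserving_integral d (T : measurableType d)
    (mu : {measure set T -> \bar R}) (f : T -> T) (g : T -> \bar R) :
  measure_preserving mu f -> measurable_fun setT g -> (forall x, 0 <= g x)%E ->
  (\int[mu]_x g (f x) = \int[mu]_x g x)%E.
Proof.
move=> [mf pf] mg g0.
have := @ge0_integral_pushforward _ _ T T R f mf mu setT g measurableT mg.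
rewrite preimage_setT /= => <-; last by move=> x _; exact: g0.
by apply: eq_measure_integral => A mA _; rewrite /= /pushforward pf.
Qed.

Lemma measure_preserving_ae d (T : measurableType d)
    (mu : {measure set T -> \bar R}) (f : T -> T) (P : T -> Prop) :
  measure_preserving mu f -> {ae mu, forall x, P x} ->
  {ae mu, forall x, P (f x)}.
Proof.
move=> [mf pf] [A [mA A0 PA]]; exists (f @^-1` A); split.
- by rewrite -[_ @^-1` _]setTI; exact: mf.
- by rewrite pf.
- by move=> x Px; exact: PA.
Qed.

Section Product.
Context {d1 d2} {T1 : measurableType d1} {T2 : measurableType d2}.
Variable m1 : {sigma_finite_measure set T1 -> \bar R}.
Variable m2 : {sigma_finite_measure set T2 -> \bar R}.

(** The product measure integrates the measures of the [x]-sections, and the [x]-section of the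
    preimage of [A] is the preimage under [f x] of the [x]-section of [A]. *)
Lemma measure_preserving_snd (f : T1 -> T2 -> T2) :
  measurable_fun setT (fun z : T1 * T2 => f z.1 z.2) ->
  (forall x, measure_preserving m2 (f x)) ->
  measure_preserving (m1 \x m2)%E (fun z => (z.1, f z.1 z.2)).
Proof.
move=> mf pf; split.
  by apply/measurable_fun_pair => //; exact: measurable_fst.
move=> A mA; apply: eq_integral => x _ /=.
rewrite -(proj2 (pf x) (xsection A x)); last exact: measurable_xsection.
by congr (m2 _); apply/seteqP; split => y; rewrite /xsection /= !inE.
Qed.

Lemma measure_preserving_fst (f : T2 -> T1 -> T1) :
  measurable_fun setT (fun z : T1 * T2 => f z.2 z.1) ->
  (forall y, measure_preserving m1 (f y)) ->
  measure_preserving (m1 \x m2)%E (fun z => (f z.2 z.1, z.2)).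
Proof.
move=> mf pf.
have mF : measurable_fun setT (fun z : T1 * T2 => (f z.2 z.1, z.2)).
  by apply/measurable_fun_pair => //; exact: measurable_snd.
(* The product measure is defined through [x]-sections; by uniqueness it may be computed through
   [y]-sections, which suit a map moving the first factor. *)
have swapE A : measurable A -> (m1 \x m2)%E A = (m1 \x^ m2)%E A.
  by apply: product_measure_unique => B C mB mC; exact: product_measure2E.
split=> // A mA; rewrite !swapE//; last by rewrite -[_ @^-1` _]setTI; exact: mF.
apply: eq_integral => y _ /=.
rewrite -(proj2 (pf y) (ysection A y)); last exact: measurable_ysection.
by congr (m1 _); apply/seteqP; split => x; rewrite /ysection /= !inE.
Qed.

End Product.

Lemma measure_preserving_addr (c : R) :
  measure_preserving (@lebesgue_measure R) (fun t : R => t + c).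
Proof.
have mf : measurable_fun setT (fun t : R => t + c).
  exact: measurable_funD.
split; first exact: mf.
move=> A mA; rewrite -/(pushforward lebesgue_measure (fun t : R => t + c) A).
apply/esym/(@lebesgue_measure_unique R (pushforward lebesgue_measure
  (fun t : measurableTypeR R => t + c : measurableTypeR R))) => //= _ [[a b]] _ <-.
rewrite /pushforward.
rewrite (_ : _ @^-1` _ = `](a - c), (b - c)]%classic); last first.
  by apply/seteqP; split => x /=; rewrite !in_itv/= ltrBlDr lerBrDr.
rewrite !lebesgue_measure_itv/= !lte_fin ltrD2r; case: ifP => // _.
by rewrite -!EFinB; congr (_%:E); ring.
Qed.

Lemma measure_preserving_subl (c : R) :
  measure_preserving (@lebesgue_measure R) (fun t : R => c - t).
Proof.
rewrite (_ : (fun t => _) = (fun t => t + c) \o -%R); last first.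
  by apply/funext => t /=; rewrite addrC.
apply: measure_preserving_comp; first exact: measure_preserving_addr.
by split=> // A mA; exact: lebesgue_measureN.
Qed.

End MeasurePreserving.
Arguments measure_preserving {R d T}.

(** * Euclidean reflections *)

Section Geometry.
Variable R : realType.

Fixpoint edot (n : nat) : E R n -> E R n -> R :=
  match n return E R n -> E R n -> R with
  | 0 => fun x y : R => x * y
  | n'.+1 => fun x y => edot n' x.1 y.1 + x.2 * y.2
  end.

(* eaxpy k a x = x + k a *)
Fixpoint eaxpy (n : nat) (k : R) : E R n -> E R n -> E R n :=
  match n return E R n -> E R n -> E R n with
  | 0 => fun a x : R => x + k * a
  | n'.+1 => fun a x => (eaxpy n' k a.1 x.1, x.2 + k * a.2)
  end.

Lemma edotxx n x : edot n x x = esqnorm R n x.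
Proof. by elim: n x => [|n IHn] x /=; rewrite ?IHn expr2. Qed.

Lemma edot_sub n x y a : edot n (esub R n x y) a = edot n x a - edot n y a.
Proof. by elim: n x y a => [|n IHn] x y a /=; rewrite ?IHn; ring. Qed.

Lemma edot_axpy n k b x a :
  edot n (eaxpy n k b x) a = edot n x a + k * edot n b a.
Proof. by elim: n x b a => [|n IHn] x b a /=; rewrite ?IHn; ring. Qed.

Lemma esqnorm_axpy n k a x :
  esqnorm R n (eaxpy n k a x) =
  esqnorm R n x + 2 * k * edot n x a + k ^+ 2 * esqnorm R n a.
Proof. by elim: n x a => [|n IHn] x a /=; rewrite ?IHn; ring. Qed.

Lemma esub_axpy n k l a x y :
  esub R n (eaxpy n k a x) (eaxpy n l a y) = eaxpy n (k - l) a (esub R n x y).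
Proof.
by elim: n x y a => [|n IHn] x y a /=; rewrite ?IHn; [|congr (_, _)]; ring.
Qed.

Lemma eaxpyD n k l a x : eaxpy n k a (eaxpy n l a x) = eaxpy n (k + l) a x.
Proof.
by elim: n x a => [|n IHn] x a /=; rewrite ?IHn; [|congr (_, _)]; ring.
Qed.

Lemma eaxpy0 n a x : eaxpy n 0 a x = x.
Proof.
elim: n x a => [|n IHn] /=; first by move=> x a; ring.
by move=> [x t] a /=; rewrite IHn mul0r addr0.
Qed.

Lemma eaxpy1_zero n a : eaxpy n 1 a (ezero R n) = a.
Proof.
elim: n a => [|n IHn] /=; first by move=> a; ring.
by move=> [x t] /=; rewrite IHn mul1r add0r.
Qed.

Lemma edot_zero n a : edot n (ezero R n) a = 0.
Proof. by elim: n a => [|n IHn] a /=; rewrite ?IHn; ring. Qed.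

Lemma esqnorm_ge0 n x : 0 <= esqnorm R n x.
Proof.
by elim: n x => [|n IHn] x /=; rewrite ?addr_ge0 ?IHn ?sqr_ge0.
Qed.

Lemma esqnorm_eq0 n x : esqnorm R n x = 0 -> x = ezero R n.
Proof.
elim: n x => [|n IHn] /=; first by move=> x /eqP; rewrite sqrf_eq0 => /eqP.
move=> [x t] /= /eqP; rewrite paddr_eq0 ?esqnorm_ge0 ?sqr_ge0// sqrf_eq0.
by move=> /andP[/eqP/IHn -> /eqP ->].
Qed.

Lemma esub_eq0 n x y : esub R n x y = ezero R n -> x = y.
Proof.
elim: n x y => [|n IHn] /=; first by move=> x y /eqP; rewrite subr_eq0 => /eqP.
by move=> [x t] [y u] /= [/IHn -> /eqP]; rewrite subr_eq0 => /eqP ->.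
Qed.

Lemma esub0r n x : esub R n x (ezero R n) = x.
Proof.
elim: n x => [|n IHn] /=; first by move=> x; rewrite subr0.
by move=> [x t] /=; rewrite IHn subr0.
Qed.

Lemma edist_eq0 n x y : Defs.edist R n x y = 0 -> x = y.
Proof.
move=> /eqP; rewrite sqrtr_eq0 => h; apply/esub_eq0/esqnorm_eq0/eqP.
by rewrite eq_le h esqnorm_ge0.
Qed.

End Geometry.

(** * Sigma-finiteness of Lebesgue measure *)

Definition sigma_finite_measure_of d (T : measurableType d) (R : realType)
    (mu : {measure set T -> \bar R}) (h : sigma_finite setT mu) :
    {sigma_finite_measure set T -> \bar R} :=
  HB.pack (Measure.sort mu)
    (Measure_isSigmaFinite.Axioms_ (Measure.sort mu) _ (Measure.class mu) h).
Arguments sigma_finite_measure_of {d T R}.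

(* The library's canonical structure for this fact is shadowed by the one for
   products of subprobability measures. *)
Lemma sigma_finite_prod d1 d2 (T1 : measurableType d1) (T2 : measurableType d2)
    (R : realType) (m1 : {sigma_finite_measure set T1 -> \bar R})
    (m2 : {sigma_finite_measure set T2 -> \bar R}) :
  sigma_finite setT (m1 \x m2)%E.
Proof.
have /sigma_finiteP[F [FT ndF Ffin]] := sigma_finiteT m1.
have /sigma_finiteP[G [GT ndG Gfin]] := sigma_finiteT m2.
exists (fun k => F k `*` G k).
  apply/seteqP; split=> // -[x y] _.
  have [i _ Fx] : (\bigcup_i F i) x by rewrite -FT.
  have [j _ Gy] : (\bigcup_j G j) y by rewrite -GT.
  (* Both exhaustions are increasing, so the index [i + j] serves both coordinates. *)
  exists (i + j)%N => //; split.
    by have /subsetPset := ndF _ _ (leq_addr j i); apply.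
  by have /subsetPset := ndG _ _ (leq_addl i j); apply.
move=> k; have [[mF Fk] [mG Gk]] := (Ffin k, Gfin k).
split; first exact: measurableX.
by rewrite product_measure1E// lte_mul_pinfty// ge0_fin_numE.
Qed.

Lemma leb_sigma_finite (R : realType) n : sigma_finite setT (leb R n).
Proof.
elim: n => [|n IHn]; first exact: (sigma_finiteT (@lebesgue_measure R)).
exact: (sigma_finite_prod _ _ _ _ _ (sigma_finite_measure_of _ IHn)
  (@lebesgue_measure R)).
Qed.

(** The measure [leb] with its sigma-finiteness attached, as Tonelli and the product lemmas
    require. *)
Definition lebS (R : realType) n : {sigma_finite_measure set (E R n) -> \bar R} :=
  sigma_finite_measure_of (leb R n) (leb_sigma_finite R n).

(** * Measurability, and reflections as isometries preserving Lebesgue measure *)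

Section Euclidean.
Context {R : realType}.

Lemma measurable_axpy n (a : E R n) d (U : measurableType d) (k : U -> R)
    (f : U -> E R n) :
  measurable_fun setT k -> measurable_fun setT f ->
  measurable_fun setT (fun z => eaxpy R n (k z) a (f z)).
Proof.
move=> mk; elim: n a f => [|n IHn] a f mf /=.
  by apply: measurable_funD => //; exact: measurable_funM.
apply/measurable_fun_pair => /=.
  by apply: IHn; exact: (measurableT_comp measurable_fst).
apply: measurable_funD; first exact: (measurableT_comp measurable_snd).
exact: measurable_funM.
Qed.

Lemma measurable_edot n (a : E R n) d (U : measurableType d) (f : U -> E R n) :
  measurable_fun setT f -> measurable_fun setT (fun z => edot R n (f z) a).
Proof.
elim: n a f => [|n IHn] a f mf /=; first exact: measurable_funM.
apply: measurable_funD.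
  by apply: IHn; exact: (measurableT_comp measurable_fst).
by apply: measurable_funM => //; exact: (measurableT_comp measurable_snd).
Qed.

Lemma measurable_esqnorm_sub n d (U : measurableType d) (f g : U -> E R n) :
  measurable_fun setT f -> measurable_fun setT g ->
  measurable_fun setT (fun z => esqnorm R n (esub R n (f z) (g z))).
Proof.
elim: n f g => [|n IHn] f g mf mg /=.
  by apply: measurable_funX; exact: measurable_funB.
apply: measurable_funD.
  by apply: IHn; exact: (measurableT_comp measurable_fst).
by apply/measurable_funX/measurable_funB; exact: (measurableT_comp measurable_snd).
Qed.

Lemma measurable_edist n d (U : measurableType d) (f g : U -> E R n) :
  measurable_fun setT f -> measurable_fun setT g ->
  measurable_fun setT (fun z => Defs.edist R n (f z) (g z)).
Proof.
move=> mf mg; rewrite /Defs.edist.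
apply: (@measurableT_comp _ _ _ _ _ _ (@Num.sqrt R)); last first.
  exact: measurable_esqnorm_sub.
by apply: continuous_measurable_fun; exact: sqrt_continuous.
Qed.

(* [side n a] is the affine function equal to 1 at 0, to -1 at [a] and to 0 on the
   perpendicular bisector of 0 and [a]. *)
Definition side n (a x : E R n) : R := 1 - 2 * edot R n x a / esqnorm R n a.

(** For [a] nonzero this is x - 2 <x - a/2, a> a / |a|^2, the reflection in the perpendicular
    bisector of 0 and [a]. *)
Definition mirror n (a x : E R n) : E R n := eaxpy R n (side n a x) a x.

Lemma measurable_side n (a : E R n) : measurable_fun setT (side n a).
Proof.
apply: measurable_funB => //; apply: measurable_funM => //.
by apply: measurable_funM => //; exact: measurable_edot.
Qed.

Lemma leb_axpy n k (a : E R n) : measure_preserving (leb R n) (eaxpy R n k a).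
Proof.
elim: n a => [|n IHn] a /=; first exact: measure_preserving_addr.
rewrite (_ : (fun x => _) =
  (fun z : E R n * R => (eaxpy R n k a.1 z.1, z.2)) \o
  (fun z : E R n * R => (z.1, z.2 + k * a.2)))//.
apply: measure_preserving_comp.
  apply: (measure_preserving_fst (lebS R n) (@lebesgue_measure R)
    (fun _ => eaxpy R n k a.1)) => //.
  by apply: measurable_axpy => //; exact: measurable_fst.
apply: (measure_preserving_snd (lebS R n) (@lebesgue_measure R)
  (fun _ t => t + k * a.2)) => //.
  by apply: measurable_funD => //; exact: measurable_snd.
by move=> _; exact: measure_preserving_addr.
Qed.

(* When the last coordinate [c] of [a = (a', c)] is nonzero, the shears
   [(x, t) |-> (x, t + <x, a'> / c)] and [(x, r) |-> (x - r (c / |a|^2) a', r)]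
   conjugate the mirror to the map [(x, r) |-> (x, |a|^2 / c - r)]. *)
Lemma leb_mirror n (a : E R n) : esqnorm R n a != 0 ->
  measure_preserving (leb R n) (mirror n a).
Proof.
elim: n a => [|n IHn] a a0 /=.
  rewrite (_ : mirror 0 a = (fun x : R => (a : R) - x)).
    exact: measure_preserving_subl.
  apply/funext => x; rewrite /mirror /side /=; move: a0 => /=.
  by rewrite sqrf_eq0 => a0; field.
case: a a0 => a c /= a0.
have [c0|c0] := eqVneq c 0.
  (* Here the bisector is parallel to the last axis, so the mirror acts on the first factor alone
     and the induction hypothesis applies. *)
  rewrite (_ : mirror n.+1 _ =
      (fun z : E R n * R => (mirror n a z.1, z.2))); last first.
    apply/funext => -[x t]; rewrite /mirror /side /= c0.
    by rewrite !mulr0 !addr0 expr0n addr0.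
  move: a0; rewrite c0 expr0n addr0 => a0.
  apply: (measure_preserving_fst (lebS R n) (@lebesgue_measure R)
    (fun _ => mirror n a)) => //.
    have [mm _] := IHn _ a0.
    by apply: measurableT_comp => //; exact: measurable_fst.
  by move=> _; exact: IHn.
set m := esqnorm R n a + c ^+ 2 in a0.
pose S1 (e : R) (z : E R n * R) := (z.1, z.2 + e * edot R n z.1 a / c).
pose S2 (e : R) (z : E R n * R) := (eaxpy R n (e * z.2 * c / m) a z.1, z.2).
pose D (z : E R n * R) := (z.1, m / c - z.2).
have pS1 e : measure_preserving (leb R n.+1) (S1 e).
  apply: (measure_preserving_snd (lebS R n) (@lebesgue_measure R)
    (fun x t => t + e * edot R n x a / c)).
    apply: measurable_funD; first exact: measurable_snd.
    apply: measurable_funM => //; apply: measurable_funM => //.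
    by apply: measurable_edot; exact: measurable_fst.
  by move=> x; exact: measure_preserving_addr.
have pS2 e : measure_preserving (leb R n.+1) (S2 e).
  apply: (measure_preserving_fst (lebS R n) (@lebesgue_measure R)
    (fun t => eaxpy R n (e * t * c / m) a)).
    apply: measurable_axpy; last exact: measurable_fst.
    apply: measurable_funM => //; apply: measurable_funM => //.
    by apply: measurable_funM => //; exact: measurable_snd.
  by move=> x; exact: leb_axpy.
have pD : measure_preserving (leb R n.+1) D.
  apply: (measure_preserving_snd (lebS R n) (@lebesgue_measure R)
    (fun _ t => m / c - t)).
    by apply: measurable_funB => //; exact: measurable_snd.
  by move=> x; exact: measure_preserving_subl.
rewrite (_ : mirror n.+1 _ =
    S1 (-1) \o (S2 1 \o (D \o (S2 (-1) \o S1 1)))); last first.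
  apply/funext => -[x t]; rewrite /mirror /side /S1 /S2 /D /= -/m.
  rewrite eaxpyD !edot_axpy edotxx.
  have -> : esqnorm R n a = m - c ^+ 2 by rewrite /m addrK.
  congr (_, _); last by field; rewrite a0 c0.
  by congr (eaxpy R n _ _ _); field; rewrite a0 c0.
by do 4! [apply: measure_preserving_comp => //].
Qed.

Section Mirror.
Variables (n : nat) (a : E R n).
Hypothesis a0 : esqnorm R n a != 0.

Lemma side_mirror x : side n a (mirror n a x) = - side n a x.
Proof. by rewrite /mirror {1 3}/side edot_axpy edotxx /side; field. Qed.

Lemma mirrorK : involutive (mirror n a).
Proof.
move=> x; rewrite {1}/mirror side_mirror /mirror eaxpyD addNr.
exact: eaxpy0.
Qed.

Lemma mirror_fixed x : side n a x = 0 -> mirror n a x = x.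
Proof. by rewrite /mirror => ->; exact: eaxpy0. Qed.

Lemma mirror_zero : mirror n a (ezero R n) = a.
Proof.
by rewrite /mirror /side edot_zero mulr0 mul0r subr0; exact: eaxpy1_zero.
Qed.

(** The signed distance of [x] to the bisector is d(x) = |a| [side n a x] / 2, and the difference of
    the squared distances is (d(x) + d(y))^2 - (d(x) - d(y))^2 = 4 d(x) d(y). *)
Lemma esqnorm_sub_mirror x y :
  esqnorm R n (esub R n (mirror n a x) y) =
  esqnorm R n (esub R n x y) + esqnorm R n a * side n a x * side n a y.
Proof.
rewrite -{1}(eaxpy0 R n a y) esub_axpy subr0 esqnorm_axpy edot_sub /side.
by field.
Qed.

Lemma edist_mirror x y :
  Defs.edist R n (mirror n a x) (mirror n a y) = Defs.edist R n x y.
Proof.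
rewrite /Defs.edist; congr Num.sqrt.
rewrite /mirror esub_axpy esqnorm_axpy edot_sub /side.
by field.
Qed.

Lemma edist_mirror_ge x y : 0 <= side n a x * side n a y ->
  Defs.edist R n x y <= Defs.edist R n (mirror n a x) y.
Proof.
move=> h; rewrite /Defs.edist ler_wsqrtr// esqnorm_sub_mirror lerDl -mulrA.
by rewrite mulr_ge0 ?esqnorm_ge0.
Qed.

End Mirror.
End Euclidean.

(** * Polarization *)

Section Fold.
Local Open Scope ereal_scope.
Context d (T : measurableType d) (R : realType).
Variables (mu : {measure set T -> \bar R}) (s : T -> T).
Hypothesis ps : measure_preserving mu s.

Lemma integral_fold (f : T -> \bar R) :
  measurable_fun setT f -> (forall x, 0 <= f x) ->
  \int[mu]_x (f x + f (s x)) = \int[mu]_x f x + \int[mu]_x f x.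
Proof.
move=> mf f0; rewrite ge0_integralD//=.
  by rewrite (measure_preserving_integral _ _ mu s f).
by apply: (measurableT_comp mf); exact: (proj1 ps).
Qed.

(** The contrapositive adds [y < x] to itself, which is valid for infinite values too. *)
Lemma lee_double (x y : \bar R) : x + x <= y + y -> x <= y.
Proof. by apply: contraTT; rewrite -!ltNge => xy; exact: lteD. Qed.

(** As [s] preserves [mu], summing over the pair {x, s x} doubles each integral, so a comparison
    pair by pair suffices. *)
Lemma le_integral_fold (f g : T -> \bar R) :
  measurable_fun setT f -> measurable_fun setT g ->
  (forall x, 0 <= f x) -> (forall x, 0 <= g x) ->
  (forall x, f x + f (s x) <= g x + g (s x)) ->
  \int[mu]_x f x <= \int[mu]_x g x.
Proof.
move=> mf mg f0 g0 fg; apply: lee_double; rewrite -!integral_fold//.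
have mD (k : T -> \bar R) : measurable_fun setT k ->
    measurable_fun setT (fun x => k x + k (s x)).
  move=> mk; apply: emeasurable_funD => //.
  by apply: (measurableT_comp mk); exact: (proj1 ps).
by apply: ge0_le_integral => //;
  [move=> x _; exact: adde_ge0|exact: mD|exact: mD].
Qed.

Lemma eq_integral_fold (f g : T -> \bar R) :
  measurable_fun setT f -> measurable_fun setT g ->
  (forall x, 0 <= f x) -> (forall x, 0 <= g x) ->
  (forall x, f x + f (s x) = g x + g (s x)) ->
  \int[mu]_x f x = \int[mu]_x g x.
Proof.
move=> mf mg f0 g0 fg; apply/eqP; rewrite eq_le.
by rewrite !le_integral_fold// => x; rewrite fg.
Qed.

End Fold.

(* The difference of the two sides is 0 or 2 (k - l) |p - p'| |q - q'|. *)
Lemma four_point (R : realDomainType) (k l p p' q q' : R) : l <= k ->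
  let M := Num.max p p' in let m := Num.min p p' in
  let M' := Num.max q q' in let m' := Num.min q q' in
  (M - M') ^+ 2 * k + (m - M') ^+ 2 * l + ((M - m') ^+ 2 * l + (m - m') ^+ 2 * k)
  <= (p - q) ^+ 2 * k + (p' - q) ^+ 2 * l + ((p - q') ^+ 2 * l + (p' - q') ^+ 2 * k).
Proof.
rewrite -subr_ge0 => lk /=.
have [pp|/ltW pp] := leP p p'; have [qq|/ltW qq] := leP q q'.
- by rewrite le_eqVlt; apply/orP; left; apply/eqP; ring.
- rewrite -subr_ge0; move: pp qq; rewrite -(subr_ge0 p) -(subr_ge0 q') => pp qq.
  rewrite (_ : _ - _ = 2 * ((k - l) * ((p' - p) * (q - q')))); last by ring.
  by rewrite !mulr_ge0.
- rewrite -subr_ge0; move: pp qq; rewrite -(subr_ge0 p') -(subr_ge0 q) => pp qq.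
  rewrite (_ : _ - _ = 2 * ((k - l) * ((p - p') * (q' - q)))); last by ring.
  by rewrite !mulr_ge0.
- by rewrite le_eqVlt; apply/orP; left; apply/eqP; ring.
Qed.

(** * Polarization along an abstract measure-preserving involution *)

Section Polarization.
Context d (T : measurableType d) (R : realType).
Variable mu : {sigma_finite_measure set T -> \bar R}.
Variables (s : T -> T) (h : T -> R) (K : T -> T -> R).
Hypothesis sK : involutive s.
Hypothesis ps : measure_preserving mu s.
Hypothesis hs : forall x, h (s x) = - h x.
Hypothesis h0 : forall x, h x = 0 -> s x = x.
Hypothesis mh : measurable_fun setT h.
Hypothesis K0 : forall x y, 0 <= K x y.
Hypothesis Ks : forall x y, K (s x) (s y) = K x y.
(* The diagonal is excluded because [0 `^ q] inverted is the junk value 0. *)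
Hypothesis Kle : forall x y, 0 <= h x * h y -> x <> y -> K (s x) y <= K x y.
Hypothesis mK : measurable_fun setT (fun z : T * T => K z.1 z.2).

Definition polarize (u : T -> R) (x : T) : R :=
  if 0 <= h x then Num.max (u x) (u (s x)) else Num.min (u x) (u (s x)).

Lemma measurable_polarize (u : T -> R) : measurable_fun setT u ->
  measurable_fun setT (polarize u).
Proof.
move=> mu'; have mus : measurable_fun setT (u \o s).
  by apply: measurableT_comp => //; exact: (proj1 ps).
apply: measurable_fun_ifT; first exact: measurable_fun_ler.
  exact: measurable_maxr.
exact: measurable_minr.
Qed.

Lemma polarize_ge0 u x : 0 <= h x -> polarize u x = Num.max (u x) (u (s x)).
Proof. by rewrite /polarize => ->. Qed.

(** Off the mirror [h] changes sign under [s]; on it [s x = x], and the maximum and the minimum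
    coincide. *)
Lemma polarize_mirror u x : 0 <= h x ->
  polarize u (s x) = Num.min (u x) (u (s x)).
Proof.
rewrite le_eqVlt => /predU1P[/esym hx|hx].
  by rewrite /polarize !h0// hx lexx maxxx minxx.
by rewrite /polarize hs sK oppr_ge0 leNgt hx /= minC.
Qed.

(** On {x, s x} the two values are kept or swapped, so symmetric sums survive. Later [phi] is a
    square or a [p]-th power of the absolute value. *)
Lemma polarize_pair (V : zmodType) (phi : R -> V) u x :
  phi (polarize u x) + phi (polarize u (s x)) = phi (u x) + phi (u (s x)).
Proof.
wlog hx : x / 0 <= h x.
  move=> W; have [/W//|hx] := leP 0 (h x).
  have := W (s x); rewrite hs oppr_ge0 sK => /(_ (ltW hx)).
  by rewrite addrC => ->; rewrite addrC.
rewrite polarize_ge0// polarize_mirror//.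
by have [_|_] := leP (u x) (u (s x)); rewrite // addrC.
Qed.

Let F u (z : T * T) : R := (u z.1 - u z.2) ^+ 2 * K z.1 z.2.
(** The four-point sum over {x, s x} and {y, s y}; its invariance under [s] in each variable allows
    both points to be moved to the side where [h] is nonnegative. *)
Let G u x y : R := F u (x, y) + F u (s x, y) + (F u (x, s y) + F u (s x, s y)).

Let Gs1 u x y : G u (s x) y = G u x y.
Proof. by rewrite /G sK; ring. Qed.

Let Gs2 u x y : G u x (s y) = G u x y.
Proof. by rewrite /G sK; ring. Qed.

(** Once [x] and [y] lie on the nonnegative side, this is [four_point] with [k] equal to [K x y] and
    [l] equal to [K (s x) y]. *)
Lemma polarize_energy_pointwise u x y : G (polarize u) x y <= G u x y.
Proof.
wlog hx : x / 0 <= h x.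
  move=> W; have [/W//|hx] := leP 0 (h x).
  by have := W (s x); rewrite hs oppr_ge0 !Gs1; apply; exact: ltW.
wlog hy : y / 0 <= h y.
  move=> W; have [/W//|hy] := leP 0 (h y).
  by have := W (s y); rewrite hs oppr_ge0 !Gs2; apply; exact: ltW.
have Ksr : K x (s y) = K (s x) y by rewrite -(Ks x) sK.
rewrite /G /F /= !Ks !Ksr !(polarize_ge0 u _ hx) !(polarize_ge0 u _ hy).
rewrite !(polarize_mirror u _ hx) !(polarize_mirror u _ hy).
(* On the diagonal [Kle] says nothing, but the terms weighted by [K y y] have zero increments and
   the two sides agree. *)
have [->|xy] := pselect (x = y).
  rewrite !subrr !expr0n !mul0r !add0r !addr0.
  have [uu|uu] := leP (u y) (u (s y)) => //.
  by rewrite addrC.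
by apply: four_point; apply: Kle => //; exact: mulr_ge0.
Qed.

Lemma polarize_norm_energy (u : T -> R) :
  let v := polarize (fun x => `|u x|) in
  measurable_fun setT u ->
  (\int[mu]_x \int[mu]_y ((v x - v y) ^+ 2 * K x y)%:E
   <= \int[mu]_x \int[mu]_y ((u x - u y) ^+ 2 * K x y)%:E)%E.
Proof.
move=> v mu0.
have mv : measurable_fun setT v.
  by apply: measurable_polarize; exact: measurableT_comp.
have mF (w : T -> R) : measurable_fun setT w -> measurable_fun setT (fun z => (F w z)%:E).
  move=> mw; apply/measurable_EFinP/measurable_funM => //; apply: measurable_funX.
  apply: measurable_funB; apply: (measurableT_comp mw);
    [exact: measurable_fst|exact: measurable_snd].
have F0 w z : (0 <= (F w z)%:E)%E by rewrite lee_fin mulr_ge0 ?sqr_ge0.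
have tonelli (w : T -> R) : measurable_fun setT w ->
    (\int[mu]_x \int[mu]_y ((w x - w y) ^+ 2 * K x y)%:E
     = \int[mu \x mu]_z (F w z)%:E)%E.
  by move=> mw; rewrite fubini_tonelli1//; exact: mF.
rewrite !tonelli//.
pose s1 (z : T * T) := (s z.1, z.2); pose s2 (z : T * T) := (z.1, s z.2).
have ps1 : measure_preserving (mu \x mu)%E s1.
  apply: (measure_preserving_fst mu mu (fun _ => s)) => //.
  by apply: (measurableT_comp (proj1 ps)); exact: measurable_fst.
have ps2 : measure_preserving (mu \x mu)%E s2.
  apply: (measure_preserving_snd mu mu (fun _ => s)) => //.
  by apply: (measurableT_comp (proj1 ps)); exact: measurable_snd.
(* Both integrals are folded along [s1] here and along [s2] below, so the integrands to compare
   become the four-point sums [G]. *)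
apply: lee_double; rewrite -!(integral_fold _ _ _ _ _ ps1)//; try exact: mF.
have mF1 (w : T -> R) : measurable_fun setT w ->
    measurable_fun setT (fun z => (F w z)%:E + (F w (s1 z))%:E)%E.
  move=> mw; apply: emeasurable_funD; first exact: mF.
  by apply: (measurableT_comp (mF _ mw)); exact: (proj1 ps1).
apply: (le_integral_fold _ _ _ _ _ ps2).
- exact: mF1.
- exact: mF1.
- by move=> z; exact: adde_ge0.
- by move=> z; exact: adde_ge0.
- move=> [x y]; rewrite -!EFinD lee_fin.
  apply: (le_trans (polarize_energy_pointwise _ x y)).
  (* By the reverse triangle inequality, passing from [u] to its absolute value does not increase
     increments. *)
  have FN z : F (fun t => `|u t|) z <= F u z.
    rewrite /F ler_wpM2r// -[leLHS]real_normK ?num_real//.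
    by rewrite -[leRHS]real_normK ?num_real// lerXn2r ?nnegrE// ler_dist_dist.
  by rewrite /G !lerD.
Qed.

End Polarization.

(** * Optimal placement of the hole *)

(** The two norms to be compared live on different domains; extending both to the whole space makes
    folding applicable. *)
Lemma integral_ae_support d (T : measurableType d) (R : realType)
    (mu : {measure set T -> \bar R}) (D : set T) (f : T -> \bar R) :
  measurable D -> measurable_fun setT f -> (forall x, 0 <= f x)%E ->
  {ae mu, forall x, ~ D x -> f x = 0%E} ->
  (\int[mu]_(x in D) f x = \int[mu]_x f x)%E.
Proof.
move=> mD mf f0 fD; rewrite integral_mkcond; apply: ge0_ae_eq_integral => //.
- by apply/(measurable_restrictT _ mD)/measurable_funTS.
- by move=> x _; exact: erestrict_ge0.
- apply: filterS fD => x fx _; rewrite patchE.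
  by case: ifPn => // /negP; rewrite inE => /fx ->.
Qed.

Lemma Gamma_ge0 (R : realType) (z : R) : 0 <= Gamma R z.
Proof.
apply/fine_ge0/integral_ge0 => t _.
by rewrite lee_fin mulr_ge0 ?powR_ge0 ?expR_ge0.
Qed.

Lemma bNs_ge0 (R : realType) N (s : R) : 0 < s < 1 -> 0 <= bNs R N s.
Proof.
move=> /andP[s0 s1]; rewrite /bNs divr_ge0 ?Gamma_ge0// mulr_ge0 ?Gamma_ge0//.
by rewrite !mulr_ge0 ?powR_ge0 ?subr_ge0// ltW.
Qed.

Section Kernel.
Context {R : realType}.
Variables (n : nat) (a : E R n) (q : R).
Hypotheses (a0 : esqnorm R n a != 0) (q0 : 0 < q).

Definition kernel_powR (x y : E R n) : R := (Defs.edist R n x y `^ q)^-1.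

Lemma kernel_powR_ge0 x y : 0 <= kernel_powR x y.
Proof. by rewrite invr_ge0 powR_ge0. Qed.

Lemma kernel_powR_mirror x y :
  kernel_powR (mirror n a x) (mirror n a y) = kernel_powR x y.
Proof. by rewrite /kernel_powR edist_mirror. Qed.

(** Reflecting one of two points on the same side increases their distance; [x <> y] keeps the
    distances positive, where inversion is decreasing. *)
Lemma kernel_powR_le x y : 0 <= side n a x * side n a y -> x <> y ->
  kernel_powR (mirror n a x) y <= kernel_powR x y.
Proof.
move=> hxy xy; have le := edist_mirror_ge n a a0 x y hxy.
have d0 : 0 < Defs.edist R n x y.
  rewrite lt_neqAle sqrtr_ge0 andbT eq_sym; apply/eqP.
  by move=> /edist_eq0.
rewrite /kernel_powR lef_pV2 ?posrE ?powR_gt0//; last exact: lt_le_trans le.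
by rewrite ge0_ler_powR ?nnegrE ?sqrtr_ge0// ltW.
Qed.

Lemma measurable_kernel_powR :
  measurable_fun setT (fun z : E R n * E R n => kernel_powR z.1 z.2).
Proof.
rewrite (_ : (fun z => _) =
    (fun z => Defs.edist R n z.1 z.2 `^ (- q))); last first.
  by apply/funext => z; rewrite powRN.
apply: (measurableT_comp (measurable_powR _)).
by apply: measurable_edist; [exact: measurable_fst|exact: measurable_snd].
Qed.

End Kernel.

Lemma polarized_competitor (R : realType) (n : nat) (s p tau : R) (a : E R n) u :
  0 < s < 1 -> p != 0 -> esqnorm R n a != 0 ->
  let B1 := ballN R n.+1 (originN R n.+1) 1 in
  let O b := B1 `\` cballN R n.+1 b tau in
  let v := polarize _ _ _ (mirror n a) (side n a) (fun x => `|u x|) in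
  Hs0 R n.+1 s (O (originN R n.+1)) u ->
  [/\ Hs0 R n.+1 s (O a) v,
    LpnormOn R n.+1 p (O a) v = LpnormOn R n.+1 p (O (originN R n.+1)) u &
    (gagliardo R n.+1 s v <= gagliardo R n.+1 s u)%E].
Proof.
move=> s01 p0 a0 B1 O v [[mu [u2 gu]] u_out].
have pm := leb_mirror n a a0.
have mO b : measurable (O b).
  have md c : measurable_fun setT (fun x => Defs.edist R n x c).
    exact: measurable_edist.
  apply: measurableD.
    have := @measurable_fun_ltr _ _ _ _ _ (cst 1) (md (originN R n.+1))
      (@measurable_cst _ _ _ _ _ _).
    by move=> /(_ measurableT [set true] I); rewrite setTI.
  have := @measurable_fun_ler _ _ _ _ _ (cst tau) (md b)
    (@measurable_cst _ _ _ _ _ _).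
  by move=> /(_ measurableT [set true] I); rewrite setTI.
have mnu : measurable_fun setT (fun x => `|u x|) by exact: measurableT_comp.
have mv : measurable_fun setT v.
  exact: (measurable_polarize _ _ _ (lebS R n) _ _ pm (measurable_side n a)).
have pair (phi : R -> R) x :
    phi (v x) + phi (v (mirror n a x)) = phi `|u x| + phi `|u (mirror n a x)|.
  apply: polarize_pair; [exact: mirrorK|exact: side_mirror|exact: mirror_fixed].
have gvu : (gagliardo R n.+1 s v <= gagliardo R n.+1 s u)%E.
  apply: lee_wpmul2l; first by rewrite lee_fin divr_ge0// bNs_ge0.
  have q0 : 0 < n.+1%:R + 2 * s.
    by have /andP[s0 _] := s01; rewrite addr_gt0// mulr_gt0.
  apply: (polarize_norm_energy _ _ _ (lebS R n) (mirror n a) (side n a)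
    (kernel_powR n (n.+1%:R + 2 * s))) => //.
  - exact: mirrorK.
  - exact: side_mirror.
  - exact: mirror_fixed.
  - exact: measurable_side.
  - exact: kernel_powR_ge0.
  - exact: kernel_powR_mirror.
  - exact: kernel_powR_le.
  - exact: measurable_kernel_powR.
have v_out : {ae lebN R n.+1, forall x, ~ O a x -> v x = 0}.
  (* The mirror pulls null sets back to null sets, so almost everywhere the vanishing of [u] can be
     used at [x] and at its reflection together. *)
  have := measure_preserving_ae _ _ _ _ _ pm u_out.
  apply: filterS2 u_out => x ux usx Oax.
  have dxa : Defs.edist R n x a = Defs.edist R n (mirror n a x) (ezero R n).
    by rewrite -[in RHS](mirrorK n a a0 (ezero R n)) edist_mirror// mirror_zero.
  have far y : 1 <= Defs.edist R n y (ezero R n) -> ~ O (originN R n.+1) y.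
    by move=> h [yB _]; move: (le_lt_trans h yB); rewrite ltxx.
  have near y : Defs.edist R n y (ezero R n) <= tau -> ~ O (originN R n.+1) y.
    by move=> h [_ /=]; apply.
  have hx : 0 <= side n a x ->
      Defs.edist R n x (ezero R n) <= Defs.edist R n (mirror n a x) (ezero R n).
    move=> h; apply: edist_mirror_ge => //.
    by rewrite {2}/side edot_zero mulr0 mul0r subr0 mulr1.
  (* Outside the unit ball [u x] is 0, which settles the minimum. On the side of 0 the reflected
     point is even farther from 0, so the maximum is 0 as well. *)
  have [x1|x1] := leP 1 (Defs.edist R n x (ezero R n)).
    rewrite /v /polarize (ux (far _ x1)) normr0; case: ifPn => [/hx xs|_].
      by rewrite usx ?normr0 ?maxxx//; exact/far/(le_trans x1).
    by rewrite min_l.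
  (* In the hole at [a] the reflected point lies in the hole at 0. On the side of 0, [x] is at least
     as close to 0 as its reflection, so it lies in that hole too. *)
  have xa : Defs.edist R n x a <= tau.
    by apply: contrapT => h; apply: Oax; split.
  rewrite /v /polarize usx ?normr0; last by apply: near; rewrite -dxa.
  case: ifPn => [/hx xs|_]; last by rewrite min_r.
  rewrite ux ?normr0 ?maxxx//; apply: near.
  by rewrite (le_trans xs)// -dxa.
split=> //.
- split=> //; split=> //; split; last exact: le_lt_trans gu.
  rewrite (_ : integral _ _ _ = \int[lebN R n.+1]_x ((u x) ^+ 2)%:E)%E//.
  apply: (eq_integral_fold _ _ _ (leb R n) (mirror n a) pm).
  + by apply/measurable_EFinP; exact: measurable_funX.
  + by apply/measurable_EFinP; exact: measurable_funX.
  + by move=> x; rewrite lee_fin sqr_ge0.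
  + by move=> x; rewrite lee_fin sqr_ge0.
  + move=> x; rewrite -!EFinD; congr (_%:E).
    by rewrite (pair (fun t => t ^+ 2)) !real_normK ?num_real.
- have mp (w : E R n -> R) : measurable_fun setT w ->
      measurable_fun setT (fun x => (`|w x| `^ p)%:E).
    move=> mw; apply/measurable_EFinP.
    by apply: (measurableT_comp (measurable_powR _)); exact: measurableT_comp.
  have p_ge0 (w : E R n -> R) x : (0 <= (`|w x| `^ p)%:E)%E.
    by rewrite lee_fin powR_ge0.
  have supp b (w : E R n -> R) : measurable_fun setT w ->
      {ae lebN R n.+1, forall x, ~ O b x -> w x = 0} ->
      (\int[lebN R n.+1]_(x in O b) (`|w x| `^ p)%:E =
       \int[lebN R n.+1]_x (`|w x| `^ p)%:E)%E.
    move=> mw w_out; apply: integral_ae_support => //; first exact: mp.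
    (* As 0 to the power 0 is 1, [p != 0] is what makes the integrand vanish with [w]. *)
    by apply: filterS w_out => x wx /wx ->; rewrite normr0 powR0.
  rewrite /LpnormOn !supp//; congr (_ `^ _)%E.
  apply: (eq_integral_fold _ _ _ (leb R n) (mirror n a) pm) => //.
  + exact: mp.
  + exact: mp.
  + move=> x; rewrite -!EFinD; congr (_%:E).
    by rewrite (pair (fun t => `|t| `^ p)) !normr_id.
Qed.

Theorem theorem1p4 (R : realType) (N : nat) (s p tau : R) :
  (0 < N)%N ->
  0 < s < 1 ->
  (p = 1 \/ p = 2) ->
  admissible R N s p ->
  0 < tau < 1 ->
  let B1 := ballN R N (originN R N) 1 in
  let A := [set a : RN R N | B1 a /\ ballN R N a tau `<=` B1] in
  let F := fun a : RN R N => lambda_sp R N s p (B1 `\` cballN R N a tau) in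
  A (originN R N) /\ (forall a, A a -> (F a <= F (originN R N))%E).
Proof.
case: N => // n _ s01 p12 _ /andP[tau0 tau1] B1 A F; split.
  split=> [|x /lt_trans]; last exact.
  rewrite /B1 /ballN /distN /= /Defs.edist esub0r -edotxx edot_zero.
  by rewrite sqrtr0 ltr01.
move=> a _.
(* At [a = 0] there is no mirror, and the two values of [F] coincide. *)
have [a0|a0] := eqVneq (esqnorm R n a) 0.
  by rewrite (esqnorm_eq0 _ _ _ a0).
have p0 : p != 0 by case: p12 => ->; rewrite ?oner_eq0 ?pnatr_eq0.
(* Each competitor for the hole at 0 yields one for the hole at [a] with no larger seminorm, which
   bounds the infimum at [a]. *)
apply: le_ereal_inf_tmp => _ [u [Hu Lu] <-].
have [Hv Lv gvu] := polarized_competitor R n s p tau a u s01 p0 a0 Hu.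
apply: (le_trans _ gvu); apply: ereal_inf_lbound.
exists (polarize _ _ _ (mirror n a) (side n a) (fun x => `|u x|)) => //.
by split; rewrite ?Lv.
Qed.
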